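(* Suppose $f:\mathbb{R}^n\to\mathbb{R}$ is bounded from below and twice continuously differentiable, and its Hessian is bounded by $\kappa_H$ and Lipschitz continuous with Lipschitz constant $L$. Let $\{\boldsymbol{x}_k\}_{k\in\mathbb{N}}$ be generated by MD-LAMBO (trust-region form, described in the context), where the subspaces satisfy $\mathcal{S}_k\ne\mathcal{S}_{\boldsymbol{s}_1,\boldsymbol{s}_2}^{(1,\sigma)}$ ($\sigma\ge0$). Let $\mathcal{K}=\{k\in\mathbb{N}:\rho_k\ge\eta_0\}$ and suppose that for any $k\in\mathcal{K}$ there exists $k'\ge k$, $k'\in\mathcal{K}$, such that $m_{k'}$ satisfies the eigenvalue condition (E) of the context. Then $$\inf_{k\le N}\|\nabla f(\boldsymbol{x}_k)\|\to0\quad\text{as }N\to\infty .$$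
   Context: Eigenvalue condition (E): $\nabla^2m_k(\boldsymbol{0})$ is positive definite and, with $q=\dim(\mathcal{S}_k)$ and eigenvalues $\lambda_1,\dots,\lambda_q$ of $\nabla^2m_k(\boldsymbol{0})$, $\bigl(\sum_{i=1}^q\lambda_i^2\bigr)\bigl(\sum_{i=1}^q1/\lambda_i\bigr)\le c$, where $c\in[1/4,1/2]$ is a constant independent of $k$. Subspaces. Fix $\sigma\ge0$. At iteration $k$ let $p_k(\boldsymbol{s})=f(\boldsymbol{x}_k)+\nabla f(\boldsymbol{x}_k)^\top\boldsymbol{s}+\frac12\boldsymbol{s}^\top\nabla^2f(\boldsymbol{x}_k)\boldsymbol{s}+\frac\sigma3\|\boldsymbol{s}\|^3$, $\boldsymbol{s}_1=(\boldsymbol{x}_{k-2}-\boldsymbol{x}_k)/\|\boldsymbol{x}_{k-2}-\boldsymbol{x}_k\|$, $\boldsymbol{s}_2=(\boldsymbol{x}_{k-1}-\boldsymbol{x}_k)/\|\boldsymbol{x}_{k-1}-\boldsymbol{x}_k\|$ (assumed distinct, for subspaces that use them). $\mathcal{S}_k$ is either of first type, $\bigcup_{\boldsymbol{s}\in\mathcal{W}}\mathrm{span}\{\nabla p_k(\boldsymbol{s})\}$, with $\mathcal{W}$ one of $\mathcal{B}(\boldsymbol{0};1)$, $\mathrm{span}\{\nabla p_k(\boldsymbol{0})\}$, $\{\boldsymbol{s}_1,\boldsymbol{s}_2\}$, $\mathrm{span}\{\boldsymbol{s}_1,\boldsymbol{s}_2\}$; or of second type, the linear span of $\{\nabla p_k(\boldsymbol{s}):\boldsymbol{s}\in\mathcal{W}\}$,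 with $\mathcal{W}$ one of $\mathcal{B}(\boldsymbol{0};1)$, $\mathrm{span}\{\nabla p_k(\boldsymbol{0})\}$, $\mathrm{span}\{\boldsymbol{s}_1\}\cup\mathrm{span}\{\boldsymbol{s}_2\}$, $\mathrm{span}\{\boldsymbol{s}_1,\boldsymbol{s}_2\}$. $\mathcal{S}_{\boldsymbol{s}_1,\boldsymbol{s}_2}^{(1,\sigma)}$ is the first-type one with $\mathcal{W}=\{\boldsymbol{s}_1,\boldsymbol{s}_2\}$. $\dim(\mathcal{S}_k)$ is the smallest dimension of an affine subspace containing $\mathcal{S}_k$. Iteration. $\boldsymbol{P}_k\in\mathbb{R}^{n\times q}$, $q=\dim(\mathcal{S}_k)$, has orthonormal columns obtained by Gram–Schmidt from $q$ linearly independent vectors of $\mathcal{S}_k$, the first being $\nabla f(\boldsymbol{x}_k)$; $\hat{\mathcal{S}}_k=\{\boldsymbol{P}_k^\top\boldsymbol{v}:\boldsymbol{v}\in\mathcal{S}_k\}$; $m_k(\boldsymbol{y})=f(\boldsymbol{x}_k)+\boldsymbol{g}_k^\top\boldsymbol{y}+\frac12\boldsymbol{y}^\top\boldsymbol{B}_k\boldsymbol{y}$ with $\boldsymbol{g}_k=\boldsymbol{P}_k^\top\nabla f(\boldsymbol{x}_k)$, $\boldsymbol{B}_k=\boldsymbol{P}_k^\top\nabla^2f(\boldsymbol{x}_k)\boldsymbol{P}_k$. The subproblem $\min m_k(\boldsymbol{y})$ subject to $\boldsymbol{y}\in\hat{\mathcal{S}}_k$, $\|\boldsymbol{y}\|\le\Delta_k$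 is solved approximately by Algorithm STCG below, giving $\boldsymbol{y}^*$, and $\rho_k=\dfrac{f(\boldsymbol{x}_k)-f(\boldsymbol{x}_k+\boldsymbol{P}_k\boldsymbol{y}^* )}{m_k(\boldsymbol{0})-m_k(\boldsymbol{y}^* )}$. With a fixed acceptance threshold $\eta_0\in(0,1)$ and constants $\gamma_{inc}>1>\gamma_{dec}>0$: if $\rho_k\ge\eta_0$ (successful), $\boldsymbol{x}_{k+1}=\boldsymbol{x}_k+\boldsymbol{P}_k\boldsymbol{y}^*$ and the radius may be increased (by the factor $\gamma_{inc}$) while all radii stay bounded above by some $\Delta_{\max}>0$; if $\rho_k<\eta_0$, $\boldsymbol{x}_{k+1}=\boldsymbol{x}_k$ and $\Delta_{k+1}=\gamma_{dec}\Delta_k$. Algorithm STCG. Start with $\boldsymbol{y}_0=\boldsymbol{0}$, $\boldsymbol{g}_{k,0}=\boldsymbol{g}_k$, $\boldsymbol{d}_0=-\boldsymbol{g}_k$, $i=0$. Step 1: if $\|\boldsymbol{g}_{k,i}\|=0$, output $\boldsymbol{y}_i$; if $\boldsymbol{d}_i^\top\boldsymbol{B}_k\boldsymbol{d}_i\le0$ go to Step 4; put $\alpha_i=-\boldsymbol{g}_{k,i}^\top\boldsymbol{d}_i/(\boldsymbol{d}_i^\top\boldsymbol{B}_k\boldsymbol{d}_i)$. Step 2: if $\boldsymbol{y}_i+\alpha_i\boldsymbol{d}_i\notin\hat{\mathcal{S}}_k$ go to Step 5. Step 3: if $\|\boldsymbol{y}_i+\alpha_i\boldsymbol{d}_i\|>\Delta_k$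 go to Step 4; otherwise $\boldsymbol{y}_{i+1}=\boldsymbol{y}_i+\alpha_i\boldsymbol{d}_i$, $\boldsymbol{g}_{k,i+1}=\boldsymbol{B}_k\boldsymbol{y}_{i+1}+\boldsymbol{g}_k$, $\beta_i=\|\boldsymbol{g}_{k,i+1}\|^2/\|\boldsymbol{g}_{k,i}\|^2$, $\boldsymbol{d}_{i+1}=-\boldsymbol{g}_{k,i+1}+\beta_i\boldsymbol{d}_i$, increase $i$, go to Step 1. Step 4: return $\boldsymbol{y}_i+\alpha^*\boldsymbol{d}_i$ with $\alpha^*\ge0$, $\|\boldsymbol{y}_i+\alpha^*\boldsymbol{d}_i\|=\Delta_k$. Step 5: return $\boldsymbol{y}_i+\alpha^*\boldsymbol{d}_i$ with $\alpha^*\ge0$, $\boldsymbol{y}_i+\alpha^*\boldsymbol{d}_i\in\partial\hat{\mathcal{S}}_k$.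
   Formalization: In Step 5 of Algorithm STCG the formal statement requires 0 ≤ α* ≤ α_i (the boundary point lies on the step leaving the reduced set) instead of any α* ≥ 0; with arbitrary α* the model can increase and the claim fails. *)

(* Defs.v *)
From HB Require Import structures.
From mathcomp Require Import all_boot all_order all_algebra.
From mathcomp Require Import all_classical all_reals all_analysis.
Set Implicit Arguments.
Unset Strict Implicit.
Unset Printing Implicit Defensive.
Import Order.TTheory GRing.Theory Num.Theory.
Import numFieldNormedType.Exports.
Local Open Scope classical_set_scope.
Local Open Scope ring_scope.

(* The norm `|v| of the library on matrices is the sup norm; every norm of the
   statement is the Euclidean norm [enorm].  The topology is the same. *)
Definition dot (R : realType) n (u v : 'cV[R]_n) : R := (u^T *m v) 0 0.
Definition enorm (R : realType) n (v : 'cV[R]_n) : R := Num.sqrt (dot v v).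

Definition opnorm_le (R : realType) n (A : 'M[R]_n) (c : R) : Prop :=
  forall v : 'cV[R]_n, enorm (A *m v) <= c * enorm v.

Definition posdef (R : realType) n (A : 'M[R]_n) : Prop :=
  forall v : 'cV[R]_n, v != 0 -> 0 < dot v (A *m v).

Definition grad (R : realType) n (f : 'cV[R]_n -> R) (x : 'cV[R]_n) : 'cV[R]_n :=
  \col_i 'D_(delta_mx i 0) f x.

Definition hess (R : realType) n (f : 'cV[R]_n -> R) (x : 'cV[R]_n) : 'M[R]_n :=
  \matrix_(i, j) 'D_(delta_mx j 0) (fun z => grad f z i 0) x.

Definition twice_continuously_differentiable (R : realType) n
    (f : 'cV[R]_n -> R) : Prop :=
  [/\ forall x, differentiable f x,
      forall x, differentiable (grad f) x &
      continuous (hess f)].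

(* Finite linear combinations of elements of a possibly infinite set. *)
Definition lin_span (R : realType) n (A : set 'cV[R]_n) : set 'cV[R]_n :=
  [set v | exists2 X : seq 'cV[R]_n, {in X, forall u, A u} & v \in <<X>>%VS].

Definition in_affine (R : realType) n (A : set 'cV[R]_n) (d : nat) : Prop :=
  exists a (U : {vspace 'cV[R]_n}), \dim U = d /\ (forall v, A v -> v - a \in U).

Definition affine_dim (R : realType) n (A : set 'cV[R]_n) (d : nat) : Prop :=
  in_affine A d /\ (forall d', in_affine A d' -> (d <= d')%N).

Definition boundary (T : topologicalType) (A : set T) : set T :=
  closure A `\` interior A.

(* p_k *)
Definition cubic_model (R : realType) n (f : 'cV[R]_n -> R) (sigma : R)
    (x s : 'cV[R]_n) : R :=
  f x + dot (grad f x) s + 2^-1 * dot s (hess f x *m s)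
  + sigma / 3 * enorm s ^+ 3.

Definition normalize (R : realType) n (v : 'cV[R]_n) : 'cV[R]_n :=
  (enorm v)^-1 *: v.

Definition closed_unit_ball (R : realType) n : set 'cV[R]_n :=
  [set s | enorm s <= 1].

(* [Union_]: union of the lines span{grad p s}, s in W (first type);
   [Span_]: linear span of all the grad p s, s in W (second type). *)
Inductive subspace_choice :=
  | Union_ball | Union_gradient | Union_pair | Union_plane
  | Span_ball | Span_gradient | Span_lines | Span_plane.

Definition uses_previous_iterates (c : subspace_choice) : bool :=
  match c with
  | Union_pair | Union_plane | Span_lines | Span_plane => true
  | _ => false
  end.

Definition sampling_set (R : realType) n (p : 'cV[R]_n -> R)
    (s1 s2 : 'cV[R]_n) (c : subspace_choice) : set 'cV[R]_n :=
  match c with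
  | Union_ball | Span_ball => @closed_unit_ball R n
  | Union_gradient | Span_gradient => lin_span [set grad p 0]
  | Union_pair => [set s1; s2]
  | Span_lines => lin_span [set s1] `|` lin_span [set s2]
  | Union_plane | Span_plane => lin_span [set s1; s2]
  end.

Definition search_set (R : realType) n (p : 'cV[R]_n -> R)
    (s1 s2 : 'cV[R]_n) (c : subspace_choice) : set 'cV[R]_n :=
  let W := sampling_set p s1 s2 c in
  match c with
  | Union_ball | Union_gradient | Union_pair | Union_plane =>
      \bigcup_(s in W) lin_span [set grad p s]
  | Span_ball | Span_gradient | Span_lines | Span_plane =>
      lin_span [set grad p s | s in W]
  end.

Definition iterate_search_set (R : realType) n (f : 'cV[R]_n -> R) (sigma : R)
    (x : nat -> 'cV[R]_n) (k : nat) (c : subspace_choice) : set 'cV[R]_n :=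
  search_set (cubic_model f sigma (x k))
    (normalize (x (k - 2)%N - x k)) (normalize (x (k - 1)%N - x k)) c.

Definition gram_schmidt (R : realType) n q (V P : 'M[R]_(n, q)) : Prop :=
  forall j : 'I_q, col j P =
    normalize (col j V - \sum_(i < q | (i < j)%N)
                           dot (col i P) (col j V) *: col i P).

(* The gradient is required to come first only when it is nonzero, since it
   cannot belong to a linearly independent family otherwise. *)
Definition subspace_basis (R : realType) n q (S : set 'cV[R]_n)
    (g : 'cV[R]_n) (P : 'M[R]_(n, q)) : Prop :=
  P^T *m P = 1%:M /\
  exists V : 'M[R]_(n, q),
    [/\ forall j, S (col j V),
        \rank V = q,
        g != 0 -> forall j : 'I_q, nat_of_ord j = 0%N -> col j V = g &
        gram_schmidt V P].

Definition reduced_set (R : realType) n q (P : 'M[R]_(n, q))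
    (S : set 'cV[R]_n) : set 'cV[R]_q :=
  [set P^T *m v | v in S].

Definition reduced_grad (R : realType) n q (f : 'cV[R]_n -> R)
    (x : 'cV[R]_n) (P : 'M[R]_(n, q)) : 'cV[R]_q :=
  P^T *m grad f x.

Definition reduced_hess (R : realType) n q (f : 'cV[R]_n -> R)
    (x : 'cV[R]_n) (P : 'M[R]_(n, q)) : 'M[R]_q :=
  P^T *m hess f x *m P.

Definition reduced_model (R : realType) n q (f : 'cV[R]_n -> R)
    (x : 'cV[R]_n) (P : 'M[R]_(n, q)) (y : 'cV[R]_q) : R :=
  f x + dot (reduced_grad f x P) y + 2^-1 * dot y (reduced_hess f x P *m y).

(* [lam] lists the eigenvalues with their multiplicities. *)
Definition eigenvalue_condition (R : realType) (c : R) q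
    (m : 'cV[R]_q -> R) : Prop :=
  posdef (hess m 0) /\
  exists lam : 'I_q -> R,
    char_poly (hess m 0) = \prod_(i < q) ('X - (lam i)%:P) /\
    (\sum_(i < q) lam i ^+ 2) * (\sum_(i < q) (lam i)^-1) <= c.

(* [stcg B g S D y r d out]: from the iterate [y], residual gradient [r] and
   direction [d], truncated conjugate gradients may return [out].
   When the step [al] leaves S, the step length returned is that of a boundary
   point on the segment from [y] to [y + al *: d].  As S need not be convex, the
   ray may meet the boundary again beyond this segment, where the model can be
   larger than at [y]. *)
Inductive stcg (R : realType) q (B : 'M[R]_q) (g : 'cV[R]_q)
    (S : set 'cV[R]_q) (D : R) (y r d : 'cV[R]_q) : 'cV[R]_q -> Prop :=
  | stcg_stationary :
      enorm r = 0 -> stcg B g S D y r d y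
  | stcg_nonpositive_curvature (a : R) :
      enorm r != 0 -> dot d (B *m d) <= 0 ->
      0 <= a -> enorm (y + a *: d) = D ->
      stcg B g S D y r d (y + a *: d)
  | stcg_leave_set (al a : R) :
      enorm r != 0 -> 0 < dot d (B *m d) ->
      al = - dot r d / dot d (B *m d) ->
      ~ S (y + al *: d) ->
      0 <= a <= al -> boundary S (y + a *: d) ->
      stcg B g S D y r d (y + a *: d)
  | stcg_leave_region (al a : R) :
      enorm r != 0 -> 0 < dot d (B *m d) ->
      al = - dot r d / dot d (B *m d) ->
      S (y + al *: d) -> D < enorm (y + al *: d) ->
      0 <= a -> enorm (y + a *: d) = D ->
      stcg B g S D y r d (y + a *: d)
  | stcg_continue (al be : R) (y' r' d' out : 'cV[R]_q) :
      enorm r != 0 -> 0 < dot d (B *m d) ->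
      al = - dot r d / dot d (B *m d) ->
      S (y + al *: d) -> enorm (y + al *: d) <= D ->
      y' = y + al *: d ->
      r' = B *m y' + g ->
      be = enorm r' ^+ 2 / enorm r ^+ 2 ->
      d' = - r' + be *: d ->
      stcg B g S D y' r' d' out ->
      stcg B g S D y r d out.

Definition stcg_output (R : realType) q (B : 'M[R]_q) (g : 'cV[R]_q)
    (S : set 'cV[R]_q) (D : R) : 'cV[R]_q -> Prop :=
  stcg B g S D 0 g (- g).

Definition reduction_ratio (R : realType) n q (f : 'cV[R]_n -> R)
    (x : 'cV[R]_n) (P : 'M[R]_(n, q)) (y : 'cV[R]_q) : R :=
  (f x - f (x + P *m y)) / (reduced_model f x P 0 - reduced_model f x P y).

(* Trust-region MD-LAMBO.  In [mdl_distinct], [k - 2] and [k - 1] are truncated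
   subtractions, so the condition also forces [2 <= k]. *)
Record md_lambo (R : realType) n (f : 'cV[R]_n -> R)
    (sigma eta0 gamma_inc gamma_dec Delta_max : R)
    (x : nat -> 'cV[R]_n) (Delta : nat -> R) (choice : nat -> subspace_choice)
    (q : nat -> nat) (P : forall k, 'M[R]_(n, q k))
    (y : forall k, 'cV[R]_(q k)) : Prop := MdLambo {
  mdl_distinct : forall k, uses_previous_iterates (choice k) ->
    uniq [:: x (k - 2)%N; x (k - 1)%N; x k];
  mdl_dim : forall k,
    affine_dim (iterate_search_set f sigma x k (choice k)) (q k);
  mdl_basis : forall k,
    subspace_basis (iterate_search_set f sigma x k (choice k))
      (grad f (x k)) (P k);
  mdl_subproblem : forall k,
    stcg_output (reduced_hess f (x k) (P k)) (reduced_grad f (x k) (P k))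
      (reduced_set (P k) (iterate_search_set f sigma x k (choice k)))
      (Delta k) (y k);
  mdl_initial_radius : 0 < Delta 0%N;
  mdl_radius_bound : forall k, Delta k <= Delta_max;
  mdl_success : forall k, eta0 <= reduction_ratio f (x k) (P k) (y k) ->
    x k.+1 = x k + P k *m y k /\
    (Delta k.+1 = Delta k \/
     Delta k.+1 = Num.min (gamma_inc * Delta k) Delta_max);
  mdl_failure : forall k, reduction_ratio f (x k) (P k) (y k) < eta0 ->
    x k.+1 = x k /\ Delta k.+1 = gamma_dec * Delta k
}.

(* Main.v *)
(* This is the Cauchy-decrease argument for trust-region methods.  The gradient
   grad f (x k) = grad p_k 0 spans a line contained in S_k, because 0 belongs to
   every sampling set other than {s1, s2}; so the first conjugate gradient step
   never leaves S_k, and the later steps only lower the model.  The model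
   decrease is therefore at least |g| min(Delta_k, |g| / kappa) / 2.  The
   algorithm may return a step longer than Delta_k when a later step leaves S_k,
   but if Delta_k < |g| / kappa it stops at its first step, at distance exactly
   Delta_k.  Hence, if the gradients stay above eps, every small enough radius
   gives a successful iteration, the radii are bounded below, and
   f (x k) + t Delta_k decreases by a fixed amount at each iteration for a
   suitable t > 0, which contradicts the lower bound on f. *)
Require Import Defs.
From HB Require Import structures.
From mathcomp Require Import all_boot all_order all_algebra.
From mathcomp Require Import all_classical all_reals all_analysis.
From mathcomp Require Import ring lra.
Set Implicit Arguments.
Unset Strict Implicit.
Unset Printing Implicit Defensive.
Import Order.TTheory GRing.Theory Num.Theory.
Import numFieldNormedType.Exports.
Local Open Scope classical_set_scope.
Local Open Scope ring_scope.

(** * The Euclidean inner product and norm on column vectors *)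

Section EuclideanNorm.
Variable R : realType.
Implicit Types (n : nat) (a : R).

Lemma dotE n (u v : 'cV[R]_n) : dot u v = \sum_i u i 0 * v i 0.
Proof. by rewrite /dot mxE; apply: eq_bigr => i _; rewrite mxE. Qed.

Lemma dotC n (u v : 'cV[R]_n) : dot u v = dot v u.
Proof. by rewrite !dotE; apply: eq_bigr => i _; rewrite mulrC. Qed.

Lemma dotDr n (u v w : 'cV[R]_n) : dot u (v + w) = dot u v + dot u w.
Proof. by rewrite /dot mulmxDr mxE. Qed.

Lemma dotDl n (u v w : 'cV[R]_n) : dot (v + w) u = dot v u + dot w u.
Proof. by rewrite dotC dotDr !(dotC u). Qed.

Lemma dotZr n a (u v : 'cV[R]_n) : dot u (a *: v) = a * dot u v.
Proof. by rewrite /dot -scalemxAr mxE. Qed.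

Lemma dotZl n a (u v : 'cV[R]_n) : dot (a *: u) v = a * dot u v.
Proof. by rewrite dotC dotZr dotC. Qed.

Lemma dotNr n (u v : 'cV[R]_n) : dot u (- v) = - dot u v.
Proof. by rewrite -scaleN1r dotZr mulN1r. Qed.

Lemma dotNl n (u v : 'cV[R]_n) : dot (- u) v = - dot u v.
Proof. by rewrite dotC dotNr dotC. Qed.

Lemma dot0r n (u : 'cV[R]_n) : dot u 0 = 0.
Proof. by rewrite /dot mulmx0 mxE. Qed.

Lemma dot_mulmx n m (A : 'M[R]_(n, m)) (u : 'cV[R]_n) (v : 'cV[R]_m) :
  dot u (A *m v) = dot (A^T *m u) v.
Proof. by rewrite /dot trmx_mul trmxK mulmxA. Qed.

Lemma dot_ge0 n (u : 'cV[R]_n) : 0 <= dot u u.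
Proof. by rewrite dotE; apply: sumr_ge0 => i _; rewrite -expr2 sqr_ge0. Qed.

Lemma enorm_ge0 n (u : 'cV[R]_n) : 0 <= enorm u.
Proof. exact: sqrtr_ge0. Qed.

Lemma enorm_sqr n (u : 'cV[R]_n) : enorm u ^+ 2 = dot u u.
Proof. by rewrite sqr_sqrtr // dot_ge0. Qed.

Lemma enorm0 n : enorm (0 : 'cV[R]_n) = 0.
Proof. by rewrite /enorm /dot mulmx0 mxE sqrtr0. Qed.

Lemma enormZ n a (u : 'cV[R]_n) : enorm (a *: u) = `|a| * enorm u.
Proof.
by rewrite /enorm dotZl dotZr mulrA -expr2 sqrtrM ?sqr_ge0 // sqrtr_sqr.
Qed.

Lemma enormN n (u : 'cV[R]_n) : enorm (- u) = enorm u.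
Proof. by rewrite -scaleN1r enormZ normrN1 mul1r. Qed.

Lemma cauchy_schwarz n (u v : 'cV[R]_n) : `|dot u v| <= enorm u * enorm v.
Proof.
have key : dot u v ^+ 2 <= dot u u * dot v v.
  have [v0|vN0] := eqVneq (dot v v) 0.
    have w a : 0 <= dot u u + a * dot u v * 2.
      have := dot_ge0 (u + a *: v).
      by rewrite !dotDl !dotDr !dotZl !dotZr v0 (dotC v u); lra.
    have [->|uvN0] := eqVneq (dot u v) 0; first by rewrite v0 expr0n mulr0.
    (* For this [a] the quantity bounded below in [w] equals [- dot u u - 2], which is negative. *)
    by have := w (- (dot u u + 1) / dot u v); rewrite divfK //;
      have := dot_ge0 u; lra.
  have v_gt0 : 0 < dot v v by rewrite lt0r vN0 dot_ge0.
  have := dot_ge0 (dot v v *: u - dot u v *: v).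
  rewrite !dotDl !dotDr !dotNl !dotNr !dotZl !dotZr (dotC v u) => h.
  by rewrite -(ler_pM2l v_gt0); lra.
rewrite -[X in X <= _]sqrtr_sqr -sqrtrM ?dot_ge0 //.
by rewrite ler_wsqrtr.
Qed.

Lemma enormD n (u v : 'cV[R]_n) : enorm (u + v) <= enorm u + enorm v.
Proof.
rewrite -(@ler_pXn2r _ 2) ?nnegrE ?addr_ge0 ?enorm_ge0 //.
rewrite enorm_sqr !dotDl !dotDr (dotC v u) -!enorm_sqr.
by have := le_trans (ler_norm _) (cauchy_schwarz u v); nra.
Qed.

Lemma enorm_delta n (i : 'I_n) : enorm (delta_mx i 0 : 'cV[R]_n) = 1.
Proof.
rewrite /enorm dotE (bigD1 i) //= big1 ?addr0; last first.
  by move=> j ji; rewrite !mxE (negbTE ji) mul0r.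
by rewrite !mxE !eqxx mulr1 sqrtr1.
Qed.

End EuclideanNorm.

(** * Model decrease along truncated conjugate gradients *)

Section TruncatedConjugateGradients.
Variables (R : realType) (q : nat) (B : 'M[R]_q) (g : 'cV[R]_q).
Variables (S : set 'cV[R]_q) (D : R).
Hypothesis B_sym : B^T = B.

Definition quad (z : 'cV[R]_q) : R := dot g z + 2^-1 * dot z (B *m z).

(** The symmetry of [B] merges the two cross terms into the model gradient at [z]. *)
Lemma quad_step (z d : 'cV[R]_q) (a : R) :
  quad (z + a *: d) =
  quad z + a * dot (B *m z + g) d + 2^-1 * a ^+ 2 * dot d (B *m d).
Proof.
rewrite /quad mulmxDr -scalemxAr !dotDl !dotDr !dotZl !dotZr.
by rewrite (dot_mulmx B z d) B_sym (dotC d (B *m z)); field.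
Qed.

(** The ball is convex: if [al < a], then [z + al *: d] lies between [z] and [z + a *: d], hence in
    the ball. So a step cut at the radius stops no later than the minimiser on the line. *)
Lemma enorm_ray_exit (z d : 'cV[R]_q) (al a : R) :
  enorm z <= D -> 0 <= al -> D < enorm (z + al *: d) ->
  enorm (z + a *: d) = D -> a <= al.
Proof.
move=> zD al0 alD aD; rewrite leNgt; apply/negP => al_lt.
have a_gt0 : 0 < a := le_lt_trans al0 al_lt.
suff : enorm (z + al *: d) <= D by rewrite leNgt alD.
have -> : z + al *: d = (1 - al / a) *: z + (al / a) *: (z + a *: d).
  rewrite scalerDr scalerA divfK ?gt_eqF // addrA -scalerDl subrK.
  by rewrite scale1r.
have t0 : 0 <= al / a by rewrite divr_ge0 // ltW.
have t1 : al / a <= 1 by rewrite ler_pdivrMr // mul1r ltW.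
apply: le_trans (enormD _ _) _.
rewrite !enormZ aD !ger0_norm ?subr_ge0 //.
by have := enorm_ge0 z; nra.
Qed.

(** Up to the minimiser [al] on the line, the curvature term cancels at most half of the linear
    decrease. *)
Lemma quad_step_le (z d : 'cV[R]_q) (al a : R) :
  0 < dot d (B *m d) -> dot (B *m z + g) d <= 0 ->
  al = - dot (B *m z + g) d / dot d (B *m d) -> 0 <= a <= al ->
  quad (z + a *: d) <= quad z + 2^-1 * a * dot (B *m z + g) d.
Proof.
move=> c0 s0 alE /andP[a0 aal]; rewrite quad_step.
have : a * dot d (B *m d) <= - dot (B *m z + g) d.
  by rewrite -ler_pdivlMr // -alE.
by nra.
Qed.

(* Exact line search makes the new residual orthogonal to the previous
   direction, so that [dot r d = - dot r r] is preserved. *)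
Lemma stcg_descent (z r d out : 'cV[R]_q) :
  stcg B g S D z r d out -> r = B *m z + g -> dot r d = - dot r r ->
  enorm z <= D -> quad out <= quad z.
Proof.
elim=> {z r d out} [//|z r d a _ dd a0 _|z r d al a _ dd alE _ aal _
  |z r d al a _ dd alE _ exit a0 aD|z r d al be z' r' d' out _ dd alE _ stay
   z'E r'E _ d'E _ IH] rE rd zD.
- rewrite quad_step -rE rd; have := dot_ge0 r; have := sqr_ge0 a.
  by nra.
- have := quad_step_le (z := z) (al := al) dd; rewrite -rE.
  move=> /(_ a) h; apply: le_trans (h _ _ aal) _;
    rewrite // rd ?oppr_le0 ?dot_ge0 //.
  by have := dot_ge0 r; case/andP: aal; nra.
- have al0 : 0 <= al by rewrite alE rd opprK divr_ge0 ?dot_ge0 // ltW.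
  have aal : 0 <= a <= al by rewrite a0 (enorm_ray_exit zD al0 exit aD).
  have := quad_step_le (z := z) (al := al) dd; rewrite -rE.
  move=> /(_ a) h; apply: le_trans (h _ _ aal) _;
    rewrite // rd ?oppr_le0 ?dot_ge0 //.
  by have := dot_ge0 r; nra.
- have al0 : 0 <= al by rewrite alE rd opprK divr_ge0 ?dot_ge0 // ltW.
  have r'd : dot r' d = 0.
    rewrite r'E z'E mulmxDr -addrA (addrC _ g) addrA -rE -scalemxAr.
    rewrite dotDl dotZl (dotC (B *m d)) alE divfK ?gt_eqF //; lra.
  apply: le_trans (IH r'E _ _) _; rewrite ?z'E //.
    by rewrite d'E dotDr dotNr dotZr r'd mulr0 addr0.
  have := quad_step_le (z := z) (al := al) dd; rewrite -rE.
  have aal : 0 <= al <= al by rewrite al0 lexx.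
  move=> /(_ al) h; apply: le_trans (h _ _ aal) _;
    rewrite // rd ?oppr_le0 ?dot_ge0 //.
  by have := dot_ge0 r; nra.
Qed.

(* When [S] contains the steepest descent ray, the first step cannot leave [S],
   hence the output is at least as good as the Cauchy point. *)
Lemma stcg_output_decrease (kappa : R) (out : 'cV[R]_q) :
  0 < kappa -> (forall v, dot v (B *m v) <= kappa * dot v v) ->
  0 < D -> 0 < enorm g -> (forall a, S (a *: g)) ->
  stcg_output B g S D out ->
  quad out <= - (2^-1 * enorm g * Num.min D (enorm g / kappa)) /\
  (enorm out = D \/ enorm g / kappa <= D).
Proof.
move=> k0 Bk D0 g0 Sg; rewrite /stcg_output => out_g.
have gg : dot g g = enorm g ^+ 2 by rewrite enorm_sqr.
have minD : Num.min D (enorm g / kappa) <= D by rewrite ge_min lexx.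
have ming : Num.min D (enorm g / kappa) <= enorm g / kappa.
  by rewrite ge_min lexx orbT.
have q0 : quad 0 = 0 by rewrite /quad mulmx0 !dot0r mulr0 addr0.
have dBd : dot (- g) (B *m - g) = dot g (B *m g).
  by rewrite mulmxN dotNl dotNr opprK.
have norm_ray a : 0 <= a -> enorm (0 + a *: - g) = a * enorm g.
  by move=> a0; rewrite add0r enormZ enormN ger0_norm.
have qray a : quad (0 + a *: - g) =
    - a * enorm g ^+ 2 + 2^-1 * a ^+ 2 * dot g (B *m g).
  by rewrite quad_step q0 mulmx0 !add0r dotNr dBd gg; ring.
have Sray a : S (0 + a *: - g) by rewrite add0r scalerN -scaleNr.
have slope : dot g (- g) = - enorm g ^+ 2 by rewrite dotNr gg.
(* The curvature bound puts the minimiser along [- g] at distance at least [enorm g / kappa] from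
   0. *)
have alpha_ge al : 0 < dot g (B *m g) -> al = enorm g ^+ 2 / dot g (B *m g) ->
    enorm g / kappa <= al * enorm g.
  move=> c0 ->; rewrite ler_pdivrMr //.
  have -> : enorm g ^+ 2 / dot g (B *m g) * enorm g * kappa =
    kappa * enorm g ^+ 2 / dot g (B *m g) * enorm g by ring.
  by rewrite ler_peMl ?(ltW g0) // ler_pdivlMr // mul1r -gg Bk.
case: out_g => {out} [g_stat|a _|al a _ _ _ notS|al a _ + + _ exit a0 aD
  |al be z' r' d' out _ + + _ stay -> -> _ -> rest].
- by move: g0; rewrite g_stat ltxx.
- rewrite dBd qray => c0 a0; rewrite norm_ray // => aD; split; last by left.
  by rewrite -aD in minD *; have := sqr_ge0 a; nra.
- by case: (notS (Sray _)).
- rewrite dBd slope opprK => c0 alE; split; last by left.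
  have al0 : 0 <= al by rewrite alE divr_ge0 ?sqr_ge0 // ltW.
  have zD : enorm (0 : 'cV[R]_q) <= D by rewrite enorm0 ltW.
  have := enorm_ray_exit zD al0 exit aD.
  move: aD; rewrite norm_ray // => aD.
  rewrite qray alE ler_pdivlMr // => aal.
  rewrite -aD in minD *.
  have : a * (a * dot g (B *m g)) <= a * enorm g ^+ 2 by apply: ler_wpM2l.
  have : enorm g * Num.min (a * enorm g) (enorm g / kappa)
       <= enorm g * (a * enorm g) by apply: ler_wpM2l => //; exact: ltW.
  by nra.
- rewrite dBd slope opprK => c0 alE.
  have al0 : 0 <= al by rewrite alE divr_ge0 ?sqr_ge0 // ltW.
  have ag := alpha_ge al c0 alE.
  (* The full first step stays in the region, so [enorm g / kappa <= al * enorm g <= D]. The second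
     alternative thus holds whatever the length of the final output. *)
  split; last by right; apply: le_trans ag _; rewrite -norm_ray.
  have r'd : dot (B *m (0 + al *: - g) + g) (- g) = 0.
    rewrite add0r -scalemxAr dotDl dotZl slope (dotC (B *m - g)) dBd alE.
    by rewrite divfK ?gt_eqF // addrN.
  apply: le_trans (stcg_descent rest _ _ _) _ => //.
    by rewrite dotDr dotNr dotZr r'd mulr0 addr0.
  rewrite qray.
  have alc : al ^+ 2 * dot g (B *m g) = al * enorm g ^+ 2.
    by rewrite expr2 -mulrA {2}alE divfK ?gt_eqF.
  have : enorm g * Num.min D (enorm g / kappa) <= enorm g * (al * enorm g).
    by apply: ler_wpM2l; [exact: ltW|exact: le_trans ming ag].
  by nra.
Qed.

End TruncatedConjugateGradients.

(** * Second-order calculus: mean values, symmetry of the Hessian, gradient of the cubic model *)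

Section Calculus.
Variables (R : realType) (n : nat).
Implicit Types (f : 'cV[R]_n -> R) (z u v s : 'cV[R]_n).

Lemma is_derive_line f z v (t : R) :
  differentiable f (z + t *: v) ->
  is_derive t 1 (fun t => f (z + t *: v)) ('D_v f (z + t *: v)).
Proof.
move=> df.
have E : (fun h : R => h^-1 *: (((fun t => f (z + t *: v)) \o shift t) (h *: 1)
    - f (z + t *: v))) =
  (fun h : R => h^-1 *: ((f \o shift (z + t *: v)) (h *: v) - f (z + t *: v))).
  apply/funext => h /=; congr (_ *: (f _ - _)).
  by rewrite scaler1 scalerDl addrCA.
have := diff_derivable (v := v) df.
by rewrite /derivable -E; split=> //; rewrite /derive E.
Qed.

Lemma derive_dot_grad f z v : differentiable f z ->
  'D_v f z = dot (grad f z) v.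
Proof.
move=> df; rewrite deriveE // [in LHS](matrix_sum_delta v) linear_sum dotE.
apply: eq_bigr => i _.
by rewrite linear_sum big_ord1 linearZ /= mxE deriveE // mulrC.
Qed.

Lemma derive_dot_hess f z u v : differentiable (grad f) z ->
  'D_v (fun w => dot (grad f w) u) z = dot u (hess f z *m v) /\
  differentiable (fun w => dot (grad f w) u) z.
Proof.
move=> dg.
have dgi i : differentiable (fun w => grad f w i 0) z.
  apply: (@differentiable_comp _ _ _ _ (grad f) (fun N : 'cV[R]_n => N i 0)) => //.
  exact: differentiable_coord.
have E : (fun w => dot (grad f w) u) =
    \sum_(i < n) u i 0 *: (fun w => grad f w i 0).
  apply/funext => w; rewrite fct_sumE dotE.
  by apply: eq_bigr => i _; rewrite mulrC.
rewrite E; split; last first.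
  by apply: differentiable_sum => i; exact: differentiableZ.
rewrite derive_sum; last first.
  by move=> i; apply: diff_derivable; exact: differentiableZ.
rewrite dotE; apply: eq_bigr => i _.
rewrite deriveZ; last exact: diff_derivable.
congr (_ * _); rewrite derive_dot_grad // dotE mxE; apply: eq_bigr => j _.
by rewrite !mxE.
Qed.

Variable f : 'cV[R]_n -> R.
Hypothesis f_C2 : twice_continuously_differentiable f.

Lemma mvt_line (h : 'cV[R]_n -> R) z v (a : R) :
  (forall w, differentiable h w) -> 0 < a ->
  exists2 t, 0 <= t <= a & h (z + a *: v) - h z = a * 'D_v h (z + t *: v).
Proof.
move=> dh a0.
have dl t := is_derive_line (dh (z + t *: v)).
have [t /[!in_itv]/= /andP[t0 ta]] := MVT a0 (fun t _ => dl t)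
  (derivable_within_continuous (fun t _ => @ex_derive _ _ _ _ _ _ _ (dl t))).
rewrite scale0r addr0 subr0 mulrC => E.
by exists t => //; rewrite !ltW.
Qed.

(** Two mean value theorems: along [u] for the difference of [f] on two parallel segments, then
    along [v] for the derivative of [f] in direction [u]. *)
Lemma second_difference z u v (h : R) : 0 < h ->
  exists2 w, enorm (w - z) <= h * (enorm u + enorm v) &
    f (z + h *: v + h *: u) - f (z + h *: u) - (f (z + h *: v) - f z) =
      h ^+ 2 * dot u (hess f w *m v).
Proof.
move=> h0; have [df dg _] := f_C2.
have dl (t : R) : is_derive t 1
    (fun t => f (z + h *: v + t *: u) - f (z + t *: u))
    ('D_u f (z + h *: v + t *: u) - 'D_u f (z + t *: u)).
  by apply: is_deriveB; exact: is_derive_line.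
have [t] := MVT h0 (fun t _ => dl t)
  (derivable_within_continuous (fun t _ => @ex_derive _ _ _ _ _ _ _ (dl t))).
rewrite in_itv /= => /andP[t0 th]; rewrite !scale0r !addr0 subr0 => ->.
have [s /andP[s0 sh]] := mvt_line (z + t *: u) v
  (fun w => (derive_dot_hess u u (dg w)).2) h0.
rewrite (derive_dot_hess _ _ (dg _)).1 !derive_dot_grad // addrAC => ->.
exists (z + t *: u + s *: v); last by ring.
rewrite [_ - z]addrC !addrA addNr add0r.
apply: le_trans (enormD _ _) _; rewrite !enormZ !ger0_norm ?(ltW t0) //.
have := enorm_ge0 u; have := enorm_ge0 v; have := ltW th.
by nra.
Qed.

(* The second difference is symmetric in [u] and [v], and equals
   [h ^+ 2 * dot u (H *m v)] up to O(h ^+ 3) as the Hessian is Lipschitz. *)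
Lemma hess_symmetric (L : R) z :
  (forall z w, opnorm_le (hess f z - hess f w) (L * enorm (z - w))) ->
  (hess f z)^T = hess f z.
Proof.
move=> lip.
have sym u v : dot u (hess f z *m v) = dot v (hess f z *m u).
  (* Two Hessians, each taken within [h * (enorm u + enorm v)] of [z], are replaced by [hess f z];
     each replacement costs [C / 2 * h]. *)
  pose C := 2 * (`|L| * (enorm u + enorm v) * enorm u * enorm v).
  have C0 : 0 <= C by rewrite !mulr_ge0 ?addr_ge0 ?enorm_ge0.
  (* Since [h] is arbitrary, the bound forces equality; [h = e / (C + 1)] also covers [C = 0]. *)
  suff bnd h : 0 < h -> `|dot u (hess f z *m v) - dot v (hess f z *m u)| <= C * h.
    apply/eqP; rewrite -subr_eq0 -normr_le0; apply/ler_addgt0Pr => e e0.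
    rewrite add0r; apply: le_trans (bnd (e / (C + 1)) _) _.
      by rewrite divr_gt0 // ltr_wpDl.
    by rewrite mulrCA ler_piMr ?(ltW e0) // ler_pdivrMr ?mul1r ?lerDl ?ltr_wpDl.
  move=> h0.
  have near u' v' w : enorm (w - z) <= h * (enorm u + enorm v) ->
      enorm u' * enorm v' = enorm u * enorm v ->
      `|dot u' (hess f w *m v') - dot u' (hess f z *m v')| <= C / 2 * h.
    move=> wz uv; rewrite -dotNr -dotDr -mulmxBl.
    apply: le_trans (cauchy_schwarz _ _) _.
    have := ler_wpM2l (enorm_ge0 u') (lip w z v').
    move=> /le_trans; apply.
    have -> : enorm u' * (L * enorm (w - z) * enorm v') =
      L * enorm (w - z) * (enorm u' * enorm v') by ring.
    have -> : C / 2 * h =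
      `|L| * (h * (enorm u + enorm v)) * (enorm u * enorm v).
      by rewrite /C; field.
    rewrite uv ler_wpM2r ?mulr_ge0 ?enorm_ge0 //.
    apply: le_trans (_ : `|L| * enorm (w - z) <= _).
      by rewrite ler_wpM2r ?enorm_ge0 ?ler_norm.
    by rewrite ler_wpM2l.
  have [w /near/(_ erefl) w1 E1] := second_difference z u v h0.
  have [w' w'z E2] := second_difference z v u h0.
  have w2 := near v u w'; rewrite [_ + enorm u]addrC in w'z.
  have {w2} w2 := w2 w'z (mulrC _ _).
  have E : dot u (hess f w *m v) = dot v (hess f w' *m u).
    apply: (mulfI (lt0r_neq0 (exprn_gt0 2 h0))); rewrite -E1 -E2.
    by rewrite [z + h *: v + _]addrAC; ring.
  have alg (a b c d : R) : c = d -> a - b = (d - b) - (c - a).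
    by move=> ->; ring.
  rewrite (alg _ _ _ _ E).
  apply: le_trans (ler_normB _ _) _.
  by apply: le_trans (lerD w2 w1) _; lra.
have dE (A : 'M[R]_n) i j : A i j = dot (delta_mx i 0) (A *m delta_mx j 0).
  by rewrite /dot trmx_delta -rowE -colE !mxE.
by apply/matrixP => i j; rewrite mxE [LHS]dE sym -dE.
Qed.

(** The mean value theorem is applied to [f], then to its derivative along [s]; the intermediate
    parameter [t <= 1] is bounded by 1, whence [kappa] instead of [kappa / 2]. *)
Lemma first_order_remainder (kappa : R) z s :
  0 <= kappa -> (forall w, opnorm_le (hess f w) kappa) ->
  `|f (z + s) - f z - dot (grad f z) s| <= kappa * enorm s ^+ 2.
Proof.
move=> k0 Hk; have [df dg _] := f_C2.
have [t /andP[t0 t1]] := mvt_line z s df ltr01.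
rewrite scale1r mul1r derive_dot_grad // => ->.
have [->|tN0] := eqVneq t 0.
  by rewrite scale0r addr0 subrr normr0 mulr_ge0 ?sqr_ge0.
have {tN0}t_gt0 : 0 < t by rewrite lt0r tN0.
have [r _ ->] := mvt_line z s (fun w => (derive_dot_hess s s (dg w)).2) t_gt0.
rewrite (derive_dot_hess _ _ (dg _)).1 normrM ger0_norm //.
apply: le_trans (_ : `|dot s (hess f (z + r *: s) *m s)| <= _).
  by rewrite ler_piMl.
apply: le_trans (cauchy_schwarz _ _) _.
rewrite expr2 mulrCA ler_wpM2l ?enorm_ge0 //; exact: Hk.
Qed.

(** The quadratic and cubic terms contribute O(h) to the difference quotient at 0. This identifies
    [grad f (x k)] as a sampled gradient of the cubic model. *)
Lemma grad_cubic_model0 (sigma : R) z :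
  grad (cubic_model f sigma z) 0 = grad f z.
Proof.
apply/colP => i; rewrite mxE.
set e := delta_mx i 0; apply: cvg_lim => //.
(* The error of the difference quotient is at most [|h| * C] once [|h| < 1]; the summand 1 keeps [C]
   positive. *)
pose H := dot e (hess f z *m e); pose C := `|H| + `|sigma| + 1.
have C0 : 0 < C by rewrite ltr_wpDl ?addr_ge0.
apply/cvgrPdist_lt => eps eps0; near=> h.
have hN0 : h != 0 by near: h; exact: nbhs_dnbhs_neq.
have h1 : `|h| < 1 by near: h; exact: dnbhs0_lt.
have hC : `|h| < eps / C by near: h; apply: dnbhs0_lt; rewrite divr_gt0.
have gE : dot (grad f z) e = grad f z i 0.
  rewrite dotC dotE (bigD1 i) //= big1 ?addr0 ?mxE ?eqxx ?mul1r // => j ji.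
  by rewrite mxE (negbTE ji) mul0r.
have -> : h^-1 *: ((cubic_model f sigma z \o shift 0) (h *: e) -
    cubic_model f sigma z 0) =
    grad f z i 0 + (2^-1 * h * H + sigma / 3 * (h^-1 * `|h| ^+ 3)).
  rewrite /cubic_model /= addr0 !dotZr dotZl -scalemxAr dotZr enormZ.
  rewrite enorm_delta enorm0 !mulmx0 !dot0r gE -/H expr0n /GRing.scale /=.
  by field.
rewrite opprD addrA subrr add0r normrN.
have hh : `|h^-1 * `|h| ^+ 3| <= `|h|.
  rewrite normrM normfV normrX normr_id exprS mulKf ?normr_eq0 //.
  by rewrite expr2 ler_piMl // ltW.
apply: le_lt_trans (_ : `|h| * C < _); last by rewrite -ltr_pdivlMr.
apply: le_trans (ler_normD _ _) _.
rewrite normrM (normrM 2^-1) normrM (normrM sigma).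
rewrite (ger0_norm (_ : 0 <= 2^-1)) ?invr_ge0 //.
rewrite (ger0_norm (_ : 0 <= 3^-1)) ?invr_ge0 //.
have := ler_wpM2l (normr_ge0 sigma) hh.
rewrite /C; have := mulr_ge0 (normr_ge0 h) (normr_ge0 H).
have := mulr_ge0 (normr_ge0 sigma) (normr_ge0 (h^-1 * `|h| ^+ 3)).
by have := normr_ge0 h; nra.
Unshelve. all: by end_near. Qed.

End Calculus.

(** * One trust-region iteration: model decrease and acceptance of small steps *)

Section TrustRegion.
Variables (R : realType) (n : nat).

Lemma search_set_gradient (p : 'cV[R]_n -> R) (s1 s2 : 'cV[R]_n)
    (c : subspace_choice) (a : R) :
  c <> Union_pair -> search_set p s1 s2 c (a *: grad p 0).
Proof.
move=> cN.
have span0 (A : set 'cV[R]_n) : lin_span A 0 by exists [::]; rewrite ?mem0v.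
have span1 (A : set 'cV[R]_n) u : A u -> lin_span A (a *: u).
  move=> Au; exists [:: u]; first by move=> w; rewrite inE => /eqP ->.
  by rewrite span_seq1 memvZ ?memv_line.
have W0 : sampling_set p s1 s2 c 0.
  by case: c cN => //= _; first
    [exact: span0|by left; exact: span0|by rewrite /closed_unit_ball /= enorm0].
by case: c cN W0 => //= _ W0; first
  [by exists 0 => //; exact: span1|by apply: span1; exists 0].
Qed.

(** The first column of [P] is [g] normalised, so [enorm g] is an entry of [P^T *m g]: the reduction
    does not shrink the gradient. *)
Lemma basis_gradient_norm q (S : set 'cV[R]_n) (g : 'cV[R]_n)
    (P : 'M[R]_(n, q)) :
  subspace_basis S g P -> affine_dim S q -> (forall a, S (a *: g)) ->
  enorm g <= enorm (P^T *m g).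
Proof.
move=> [_ [V [_ _ Vg PV]]] [[b [U [dimU SU]]] _] Sg.
have [->|gN0] := eqVneq g 0; first by rewrite enorm0 enorm_ge0.
have g_gt0 : 0 < enorm g.
  rewrite lt0r enorm_ge0 andbT; apply: contra_neq gN0 => g0.
  apply/colP => i; rewrite mxE; apply/eqP; rewrite -normr_le0.
  have := cauchy_schwarz (delta_mx i 0) g; rewrite g0 mulr0.
  by rewrite /dot trmx_delta -rowE mxE.
(* If [q = 0], then [S] lies in a single point but contains both 0 and [g]. *)
have [q0|q_gt0] := posnP q.
  move: gN0; rewrite q0 in dimU.
  have U0 : U = 0%VS by apply/eqP; rewrite -dimv_eq0 dimU.
  have := SU _ (Sg 0); have := SU _ (Sg 1).
  rewrite U0 !memv0 scale1r scale0r sub0r oppr_eq0 => gb /eqP b0.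
  by move: gb; rewrite b0 subr0 => ->.
pose j := Ordinal q_gt0.
have colj : col j P = (enorm g)^-1 *: g.
  by rewrite PV big_pred0 ?subr0 ?Vg // => i; rewrite ltn0.
have := cauchy_schwarz (delta_mx j 0) (P^T *m g).
rewrite enorm_delta mul1r => /(le_trans _); apply.
rewrite /dot trmx_delta -rowE row_mul -tr_col colj.
have -> : (((enorm g)^-1 *: g)^T *m g) 0 0 = enorm g.
  by rewrite -/(dot _ _) dotZl -enorm_sqr expr2 mulKf ?gt_eqF.
exact: ler_norm.
Qed.

Variable f : 'cV[R]_n -> R.
Hypothesis f_C2 : twice_continuously_differentiable f.
Variable L : R.
Hypothesis hess_lipschitz : forall z w,
  opnorm_le (hess f z - hess f w) (L * enorm (z - w)).
Variable kappa : R.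
Hypothesis kappa_gt0 : 0 < kappa.
Hypothesis hess_bounded : forall z, opnorm_le (hess f z) kappa.

Lemma reduced_modelE q (x : 'cV[R]_n) (P : 'M[R]_(n, q)) (y : 'cV[R]_q) :
  reduced_model f x P y =
  f x + quad (reduced_hess f x P) (reduced_grad f x P) y.
Proof. by rewrite /reduced_model /quad addrA. Qed.

(** For small [D] the step has length [D], so actual and predicted decrease differ by at most
    [3 / 2 * kappa * D ^+ 2]: the first-order remainder plus the quadratic term of the model. The
    factor 4 in the threshold keeps this below [1 - eta0] times the predicted decrease, itself at
    least [D * enorm (grad f x) / 2]. *)
Lemma trust_region_step (S : set 'cV[R]_n) (x : 'cV[R]_n) q
    (P : 'M[R]_(n, q)) (D eta0 : R) (y : 'cV[R]_q) :
  subspace_basis S (grad f x) P -> affine_dim S q ->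
  (forall a, S (a *: grad f x)) -> 0 < D -> 0 < eta0 < 1 ->
  0 < enorm (grad f x) ->
  stcg_output (reduced_hess f x P) (reduced_grad f x P) (reduced_set P S) D y ->
  2^-1 * enorm (grad f x) * Num.min D (enorm (grad f x) / kappa) <=
    reduced_model f x P 0 - reduced_model f x P y /\
  (D < (1 - eta0) * enorm (grad f x) / (4 * kappa) ->
   eta0 <= reduction_ratio f x P y).
Proof.
move=> basis dimS Sg D0 /andP[e0 e1] g0 out.
have gP := basis_gradient_norm basis dimS Sg.
have [PP _] := basis.
(* Orthonormal columns preserve norms, so the bound [kappa] passes to the reduced Hessian. *)
have isom z : enorm (P *m z) = enorm z.
  by rewrite /enorm dot_mulmx mulmxA PP mul1mx.
have curv z : dot z (reduced_hess f x P *m z) =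
    dot (P *m z) (hess f x *m (P *m z)).
  by rewrite -!mulmxA dot_mulmx trmxK.
have curvP z : `|dot z (reduced_hess f x P *m z)| <= kappa * dot z z.
  rewrite curv; apply: le_trans (cauchy_schwarz _ _) _.
  rewrite -enorm_sqr -[enorm z]isom expr2 mulrCA ler_wpM2l ?enorm_ge0 //.
  exact: hess_bounded.
have Bsym : (reduced_hess f x P)^T = reduced_hess f x P.
  by rewrite !trmx_mul trmxK (hess_symmetric f_C2 _ hess_lipschitz) mulmxA.
have Sray a : reduced_set P S (a *: reduced_grad f x P).
  by exists (a *: grad f x) => //; rewrite -scalemxAr.
have [dec far] := stcg_output_decrease Bsym kappa_gt0
  (fun z => le_trans (ler_norm _) (curvP z)) D0 (lt_le_trans g0 gP) Sray out.
rewrite -/(reduced_grad f x P) in gP.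
set G := enorm (reduced_grad f x P) in gP dec far.
set g := enorm (grad f x) in g0 gP *.
have gk : g / kappa <= G / kappa by rewrite ler_pM2r ?invr_gt0.
have min0 : 0 < Num.min D (g / kappa) by rewrite lt_min D0 divr_gt0.
have M : 2^-1 * g * Num.min D (g / kappa) <=
    reduced_model f x P 0 - reduced_model f x P y.
  rewrite !reduced_modelE.
  have -> : quad (reduced_hess f x P) (reduced_grad f x P) 0 = 0.
    by rewrite /quad mulmx0 !dot0r mulr0 addr0.
  have : Num.min D (g / kappa) <= Num.min D (G / kappa).
    by rewrite le_min !ge_min lexx gk orbT.
  by nra.
split=> // Dsmall.
have Dk : 4 * kappa * D < (1 - eta0) * g.
  by rewrite mulrC -ltr_pdivlMr // mulr_gt0.
(* The threshold lies below [g / kappa <= G / kappa], which rules out the second alternative of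
   [far]. *)
have Dg : D < g / kappa by rewrite ltr_pdivlMr //; nra.
have yD : enorm y = D.
  by case: far => // GD; have := lt_le_trans Dg (le_trans gk GD); rewrite ltxx.
rewrite (min_idPl (ltW Dg)) in M.
have M_gt0 : 0 < reduced_model f x P 0 - reduced_model f x P y.
  by apply: lt_le_trans M; rewrite !mulr_gt0 ?invr_gt0.
rewrite /reduction_ratio ler_pdivlMr //.
have := first_order_remainder f_C2 x (P *m y) (ltW kappa_gt0) hess_bounded.
rewrite isom yD => /(le_trans (ler_norm _)) rem.
have := curvP y; rewrite -enorm_sqr yD ler_norml => /andP[curv_ge _].
have modelE : reduced_model f x P 0 - reduced_model f x P y =
    - dot (grad f x) (P *m y) - 2^-1 * dot y (reduced_hess f x P *m y).
  rewrite /reduced_model mulmx0 !dot0r (dot_mulmx P).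
  by rewrite -/(reduced_grad f x P); ring.
move: M; rewrite modelE => M.
have : 0 <= D * ((1 - eta0) * g - 4 * kappa * D).
  by rewrite mulr_ge0 ?subr_ge0 // ltW.
have := ler_wpM2l (_ : 0 <= 1 - eta0) M; rewrite subr_ge0 => /(_ (ltW e1)).
by nra.
Qed.

Lemma search_set_line (x : nat -> 'cV[R]_n) (sigma : R) k c (a : R) :
  c <> Union_pair -> iterate_search_set f sigma x k c (a *: grad f (x k)).
Proof.
by move=> cN; rewrite -(grad_cubic_model0 f sigma); exact: search_set_gradient.
Qed.

End TrustRegion.

(** * Global convergence by a decreasing potential *)

Lemma no_infinite_uniform_decrease (R : realType) (V : nat -> R) (e l : R) :
  0 < e -> (forall k, l <= V k) -> ~ (forall k, V k.+1 <= V k - e).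
Proof.
move=> e0 lV dV.
have Vk k : V k <= V 0%N - k%:R * e.
  elim: k => [|k IH]; first by rewrite mul0r subr0.
  by apply: le_trans (dV k) _; rewrite -natr1; lra.
pose k := (Num.truncn ((V 0%N - l) / e)).+1.
have : (V 0%N - l) / e < k%:R by exact: truncnS_gt.
by rewrite ltr_pdivrMr // => h; have := lV k; have := Vk k; lra.
Qed.

Theorem theorem3p1 (R : realType) (n : nat) (f : 'cV[R]_n -> R)
  (kappa_H L : R)
  (f_bounded_below : has_lbound (range f))
  (f_C2 : twice_continuously_differentiable f)
  (hess_bounded : forall z, opnorm_le (hess f z) kappa_H)
  (hess_lipschitz : forall z w,
     opnorm_le (hess f z - hess f w) (L * enorm (z - w)))
  (sigma eta0 gamma_inc gamma_dec Delta_max c : R)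
  (sigma_ge0 : 0 <= sigma)
  (eta0_itv : 0 < eta0 < 1)
  (gamma_inc_gt1 : 1 < gamma_inc)
  (gamma_dec_itv : 0 < gamma_dec < 1)
  (Delta_max_gt0 : 0 < Delta_max)
  (c_itv : 4^-1 <= c <= 2^-1)
  (x : nat -> 'cV[R]_n) (Delta : nat -> R) (choice : nat -> subspace_choice)
  (q : nat -> nat) (P : forall k, 'M[R]_(n, q k)) (y : forall k, 'cV[R]_(q k))
  (generated : md_lambo f sigma eta0 gamma_inc gamma_dec Delta_max
     x Delta choice P y)
  (not_Union_pair : forall k, choice k <> Union_pair)
  (eigenvalue_cond : forall k,
     eta0 <= reduction_ratio f (x k) (P k) (y k) ->
     exists k', [/\ (k <= k')%N,
       eta0 <= reduction_ratio f (x k') (P k') (y k') &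
       eigenvalue_condition c (reduced_model f (x k') (P k'))]) :
  (fun N : nat => inf [set enorm (grad f (x k)) | k in [set k | (k <= N)%N]])
    @ \oo --> (0 : R).
Proof.
(* The infimum runs over a growing set of indices, so one small gradient bounds it from then on. *)
suff small eps : 0 < eps -> exists k, enorm (grad f (x k)) < eps.
  apply/cvgrPdist_lt => eps eps0; have [k0 k0eps] := small _ eps0.
  near=> N; rewrite sub0r normrN ger0_norm; last first.
    apply: lb_le_inf; first by exists (enorm (grad f (x 0%N))); exists 0%N.
    by move=> _ [k _ <-]; exact: enorm_ge0.
  apply: le_lt_trans k0eps; apply: ge_inf.
    by exists 0 => _ [k _ <-]; exact: enorm_ge0.
  by exists k0 => //=; near: N; exact: nbhs_infty_ge.
move=> eps0; apply: contrapT => /forallNP large.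
have {large} large k : eps <= enorm (grad f (x k)).
  by rewrite leNgt; apply/negP; exact: large.
have [eta0_gt0 eta0_lt1] := andP eta0_itv.
have [dec_gt0 dec_lt1] := andP gamma_dec_itv.
pose kappa := `|kappa_H| + 1.
have kappa0 : 0 < kappa by rewrite ltr_wpDl.
have Hkappa z : opnorm_le (hess f z) kappa.
  move=> v; apply: le_trans (hess_bounded z v) _.
  rewrite ler_wpM2r ?enorm_ge0 // (le_trans (ler_norm _)) //.
  by rewrite lerDl.
have step k (Dk : 0 < Delta k) := trust_region_step f_C2 hess_lipschitz kappa0
  Hkappa (mdl_basis generated k) (mdl_dim generated k)
  (fun a => search_set_line f x sigma k a (not_Union_pair k))
  Dk eta0_itv (lt_le_trans eps0 (large k)) (mdl_subproblem generated k).
pose delta := (1 - eta0) * eps / (4 * kappa).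
have delta0 : 0 < delta by rewrite divr_gt0 ?mulr_gt0 // subr_gt0.
(* A success never shrinks the radius, and a failure requires [delta <= Delta k], so it leaves at
   least [gamma_dec * delta]. *)
pose Dmin := Num.min (Delta 0%N) (gamma_dec * delta).
have Dmin0 : 0 < Dmin.
  by rewrite lt_min (mdl_initial_radius generated) mulr_gt0.
have Delta_ge k : Dmin <= Delta k.
  elim: k => [|k IH]; first by rewrite ge_min lexx.
  have Dk := lt_le_trans Dmin0 IH.
  have [succ|fail] := leP eta0 (reduction_ratio f (x k) (P k) (y k)).
    have [_ [->//|->]] := mdl_success generated succ.
    rewrite le_min (le_trans IH (mdl_radius_bound generated k)) andbT.
    by apply: le_trans IH _; rewrite ler_peMl ?ltW.
  have [_ ->] := mdl_failure generated fail.
  have delta_le : delta <= Delta k.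
    apply: le_trans (_ : (1 - eta0) * enorm (grad f (x k)) / (4 * kappa) <= _).
      by rewrite ler_pM2r ?invr_gt0 ?mulr_gt0 // ler_pM2l ?subr_gt0.
    rewrite leNgt; apply/negP => /(step k Dk).2.
    by rewrite leNgt fail.
  by rewrite ge_min orbC ler_pM2l ?delta_le.
(* A lower bound for the decrease of [f] at a successful iteration. *)
pose dec := eta0 * (2^-1 * eps * Num.min Dmin (eps / kappa)).
have min0 : 0 < Num.min Dmin (eps / kappa) by rewrite lt_min Dmin0 divr_gt0.
have dec0 : 0 < dec by rewrite !mulr_gt0 ?invr_gt0.
(* With this weight [t * Delta k] never exceeds [dec / 2], so an enlarged radius consumes at most
   half of the decrease of [f]. *)
pose t := dec / (2 * Delta_max).
have t0 : 0 < t by rewrite divr_gt0 ?mulr_gt0.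
have tE : t * Delta_max = dec / 2 by rewrite /t; field; rewrite gt_eqF.
(* The first bound serves successes; the second serves failures, where [f (x k)] is unchanged and
   only the radius term drops. *)
pose e := Num.min (dec / 2) (t * (1 - gamma_dec) * Dmin).
have [l fl] := f_bounded_below.
apply: (@no_infinite_uniform_decrease R (fun k => f (x k) + t * Delta k) e l).
- by rewrite lt_min (divr_gt0 dec0) //= mulr_gt0 // mulr_gt0 // subr_gt0.
- move=> k; apply: le_trans (_ : f (x k) <= _); first by apply: fl; exists (x k).
  by rewrite lerDl mulr_ge0 ?(ltW t0) // (le_trans (ltW Dmin0)).
move=> k /=; have Dk := lt_le_trans Dmin0 (Delta_ge k).
have [succ|fail] := leP eta0 (reduction_ratio f (x k) (P k) (y k)).
  have e_le : e <= dec / 2 by rewrite ge_min lexx.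
  have [-> _] := mdl_success generated succ.
  have : t * Delta k.+1 <= t * Delta_max.
    by rewrite ler_pM2l // (mdl_radius_bound generated).
  have tD : 0 < t * Delta k by rewrite mulr_gt0.
  have M : 2^-1 * eps * Num.min Dmin (eps / kappa) <=
      reduced_model f (x k) (P k) 0 - reduced_model f (x k) (P k) (y k).
    apply: le_trans (step k Dk).1; apply: ler_pM.
    - by rewrite mulr_ge0 ?invr_ge0 // ltW.
    - exact: ltW.
    - by rewrite ler_pM2l ?invr_gt0.
    - rewrite le_min ge_min Delta_ge /= ge_min.
      by rewrite ler_pM2r ?invr_gt0 // large orbT.
  move: succ; rewrite /reduction_ratio ler_pdivlMr; last first.
    by apply: lt_le_trans M; rewrite !mulr_gt0 ?invr_gt0.
  have : dec <= eta0 * (reduced_model f (x k) (P k) 0 -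
      reduced_model f (x k) (P k) (y k)) by rewrite ler_pM2l.
  by lra.
have e_le : e <= t * (1 - gamma_dec) * Dmin by rewrite ge_min lexx orbT.
have [-> ->] := mdl_failure generated fail.
have : t * (1 - gamma_dec) * Dmin <= t * (1 - gamma_dec) * Delta k.
  by rewrite ler_wpM2l // ltW // mulr_gt0 // subr_gt0.
by lra.
Unshelve. all: by end_near. Qed.
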